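(* Let $G_1,G_2,\dots$ be i.i.d. nonnegative random variables whose common distribution has a density and has CDF $F$ with $F(x)>0$ for all $x>0$, and let $M_n=\min\{G_1,\dots,G_n\}$. Suppose that $F(x)\sim c\,x^\alpha$ as $x\downarrow0$, for constants $c,\alpha>0$. Then: (i) The sequence $\mathcal{M}_n=n^{1/\alpha}M_n$, $n\ge1$, converges in distribution to a random variable $\mathcal{M}$ with CDF $F_{\mathcal{M}}(t)=1-\exp(-ct^\alpha)$: for any $t>0$, $$\lim_{n\to\infty}\mathsf{P}(\mathcal{M}_n>t)=\mathsf{P}(\mathcal{M}>t)=1-F_{\mathcal{M}}(t).$$ (ii) If the common mean of $\{G_k\}$ is finite, then $$\lim_{n\to\infty}n^{1/\alpha}\,\mathsf{E}[M_n]=\mathsf{E}[\mathcal{M}]=\int_0^\infty\exp(-ct^\alpha)\,dt=\mathrm{Gamma}(1/\alpha)\,\frac1\alpha\,\frac1{c^{1/\alpha}},$$ where $\mathrm{Gamma}(\cdot)$ denotes the Gamma function. (iii) Suppose that $\mathsf{E}[\exp(\theta_0G_k)]<\infty$ for some $\theta_0>0$ (and any $k$). Then for $\theta<\theta_0$, as $n\to\infty$, $$\mathsf{E}[\exp(\theta M_n)]=1+\theta\,\mathsf{E}[\mathcal{M}]\,n^{-1/\alpha}+o(n^{-1/\alpha}).$$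
   Context: $f\sim g$ means $f/g\to1$. In the application $G_i=\Gamma(X_i)-\Gamma^\star$ is the excess cost of an i.i.d. sample $X_i$ for an objective $\Gamma$ with minimum value $\Gamma^\star$. *)

(* Defs.v *)
From HB Require Import structures.
From mathcomp Require Import all_boot all_order all_algebra.
From mathcomp Require Import all_classical all_reals all_analysis.
From mathcomp Require Import measurable_realfun.

Set Implicit Arguments.
Unset Strict Implicit.
Unset Printing Implicit Defensive.

Import Order.TTheory GRing.Theory Num.Theory.
Import numFieldNormedType.Exports.

Local Open Scope classical_set_scope.
Local Open Scope ring_scope.

Definition asymp_equiv (T : Type) (R : realType) (F : set_system T)
  (f g : T -> R) : Prop := f x / g x @[x --> F] --> (1 : R).

Section random_sequences.
Context {d : measure_display} {T : measurableType d} {R : realType}.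
Variable P : probability T R.
Implicit Types (G : nat -> {RV P >-> R}) (X : {RV P >-> R}).

Definition mutually_independent G : Prop :=
  forall (s : seq nat) (A : nat -> set R),
    uniq s -> (forall i, measurable (A i)) ->
    P (\bigcap_(i in [set` s]) (G i @^-1` A i)) =
    (\prod_(i <- s) P (G i @^-1` A i))%E.

Definition identically_distributed G : Prop :=
  forall (i j : nat) (A : set R), measurable A ->
    distribution P (G i) A = distribution P (G j) A.

Definition iid G : Prop := mutually_independent G /\ identically_distributed G.

Definition has_density X : Prop :=
  exists f : R -> R,
    [/\ measurable_fun setT f, forall x, 0 <= f x &
      forall A : set R, measurable A ->
        distribution P X A = (\int[lebesgue_measure]_(x in A) (f x)%:E)%E].

End random_sequences.

(* Convergence of the CDFs at the continuity points of the limit CDF; the limit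
   may live on another probability space. *)
Definition cvg_in_distribution d d' (T : measurableType d)
    (T' : measurableType d') (R : realType)
    (P : probability T R) (P' : probability T' R)
    (Y : nat -> {RV P >-> R}) (X : {RV P' >-> R}) : Prop :=
  forall t : R, {for t, continuous (cdf X)} ->
    cdf (Y n) t @[n --> \oo] --> cdf X t.

Section sample_minimum.
Context {d : measure_display} {T : measurableType d} {R : realType}.
Implicit Type G : nat -> {mfun T >-> R}.

(* Indices start at 0: for n >= 1 this is the minimum of the first n variables
   G 0, ..., G n.-1, the seed G 0 being one of them; n = 0 is irrelevant. *)
Definition sample_min G (n : nat) : T -> R :=
  fun w => \big[Order.min/G 0%N w]_(i < n) G i w.

Let measurable_sample_min G n : measurable_fun setT (sample_min G n).
Proof.
apply: (eq_measurable_fun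
  (fun w => \big[Order.min/G 0%N w]_(i <- iota 0 n) G i w)) => [w _|].
  by rewrite /sample_min -(big_mkord xpredT (fun i => G i w)) /index_iota subn0.
elim: (iota 0 n) => [|k s IHs].
  apply: (eq_measurable_fun (G 0%N)) => [w _|]; first by rewrite big_nil.
  exact: measurable_funPT.
apply: (eq_measurable_fun
  (G k \min (fun w => \big[Order.min/G 0%N w]_(i <- s) G i w))) => [w _|].
  by rewrite big_cons.
by apply: measurable_minr => //; exact: measurable_funPT.
Qed.

HB.instance Definition _ G n :=
  isMeasurableFun.Build _ _ _ _ (sample_min G n) (measurable_sample_min G n).

Definition scaled_min (alpha : R) G (n : nat) : T -> R :=
  fun w => n%:R `^ alpha^-1 * sample_min G n w.

Let measurable_scaled_min alpha G n :
  measurable_fun setT (scaled_min alpha G n).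
Proof. by apply: measurable_funM => //; exact: measurable_funPT. Qed.

HB.instance Definition _ alpha G n :=
  isMeasurableFun.Build _ _ _ _ (scaled_min alpha G n)
    (measurable_scaled_min alpha G n).

End sample_minimum.

(* The CDF vanishes on the negative half-line, where the library's power
   function would give the junk value (t `^ alpha = 1 for t < 0). *)
Definition limit_cdf (R : realType) (c alpha t : R) : R :=
  if 0 <= t then 1 - expR (- (c * t `^ alpha)) else 0.

Definition Gamma (R : realType) (s : R) : R :=
  \int[lebesgue_measure]_(t in `]0, +oo[) (t `^ (s - 1) * expR (- t)).

(* Main.v *)
Require Import Defs.
From HB Require Import structures.
From mathcomp Require Import all_boot all_order all_algebra.
From mathcomp Require Import all_classical all_reals all_analysis.
From mathcomp Require Import measurable_realfun ring lra.

Set Implicit Arguments.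
Unset Strict Implicit.
Unset Printing Implicit Defensive.

Import Order.TTheory GRing.Theory Num.Theory.
Import numFieldNormedType.Exports.

Local Open Scope classical_set_scope.
Local Open Scope ring_scope.

(** By independence P(M_n > x) = (1 - F x)^n, so P(n^(1/alpha) M_n > t) =
    (1 - F(t n^(-1/alpha)))^n tends to exp(-c t^alpha). Writing an expectation
    as the integral of the tail, the convergence of means follows by dominated
    convergence: for t n^(-1/alpha) small the tail is at most
    exp(-c t^alpha / 2), and otherwise two of its factors are bounded by
    Markov's inequality while the others decay exponentially in n.

    The exponential moments reduce to this convergence of means. The increasing
    map phi x = (exp(theta x) - 1) / theta commutes with minima and satisfies
    phi x ~ x at 0, so phi(G_1), phi(G_2), ... fulfil the same hypotheses with
    the same c and alpha, and E exp(theta M_n) = 1 + theta E phi(M_n).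

    The limit law is realized on [0, 1] with the uniform probability as
    (- ln U / c)^(1/alpha). *)

(** * Stretched exponential integrals and the Gamma function *)

Lemma powR_le_expR (R : realType) (p c a : R) : 0 < p -> 0 < c -> 0 < a ->
  exists2 K : R, 0 < K & forall t, 0 <= t -> t `^ p <= K * expR (c * t `^ a).
Proof.
(* [ln_sublinear] at [e * t `^ a], with e chosen so that p / a * e = c. *)
move=> p0 c0 a0; pose e := c * a / p.
have e0 : 0 < e by rewrite divr_gt0 ?mulr_gt0.
exists (expR (- (p / a * ln e))) => [|t]; first exact: expR_gt0.
rewrite le_eqVlt => /predU1P[<-|t0].
  by rewrite powR0 ?gt_eqF// mulr_ge0 ?expR_ge0.
rewrite {1}/powR gt_eqF// -expRD ler_expR.
have := ln_sublinear (mulr_gt0 e0 (powR_gt0 a t0)).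
rewrite lnM ?posrE ?powR_gt0// ln_powR => /ltW.
rewrite -(@ler_pM2l _ (p / a)) ?divr_gt0// => h.
rewrite addrC lerBrDl; apply: le_trans (le_trans h _).
  by rewrite mulrDr mulrA divfK ?gt_eqF.
rewrite /e !mulrA (mulrAC _ c) divfK ?gt_eqF//.
by rewrite (mulrAC _ c) mulfV ?gt_eqF// mul1r.
Qed.

Lemma expRN_powR_le (R : realType) (c a : R) : 0 < c -> 0 < a ->
  exists2 K : R, 0 < K &
    forall t, 0 <= t -> expR (- (c * t `^ a)) <= K * (oneDsqr t)^-1.
Proof.
move=> c0 a0; have [K K0 h] := @powR_le_expR R 2%:R c a ltac:(by []) c0 a0.
exists (1 + K) => [|t t0]; first by rewrite addr_gt0.
rewrite expRN ler_pdivlMr ?oneDsqr_gt0// mulrC ler_pdivrMr ?expR_gt0//.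
rewrite mulrDl mul1r lerD//.
  by rewrite -[leLHS]expR0 ler_expR mulr_ge0 ?powR_ge0// ltW.
by rewrite -powR_mulrn// h.
Qed.

Lemma integrable_oneDsqrV_scale (R : realType) (K : R) :
  lebesgue_measure.-integrable `[0%R, +oo[%classic
    (fun t : R => (K * (oneDsqr t)^-1)%:E).
Proof.
have mq : measurable_fun setT (fun t : R => (oneDsqr t)^-1).
  by apply: continuous_measurable_fun; exact: continuous_oneDsqrV.
rewrite (_ : (fun t => _) = fun t => (K%:E * ((oneDsqr t)^-1)%:E)%E)//.
apply: integrableZl => //; apply/integrableP; split.
  exact/measurable_EFinP/measurable_funTS.
under eq_integral do rewrite gee0_abs ?lee_fin ?invr_ge0
  ?(le_trans _ (oneDsqr_ge1 _))//.
by rewrite integral0y_oneDsqr ltry.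
Qed.

Lemma integral_expRN_powR_lty (R : realType) (c a : R) : 0 < c -> 0 < a ->
  (\int[lebesgue_measure]_(t in `[0%R, +oo[)
     (expR (- (c * t `^ a)))%:E < +oo)%E.
Proof.
move=> c0 a0; have [K K0 h] := expRN_powR_le c0 a0.
apply: integrable_lty => //.
apply: le_integrable (integrable_oneDsqrV_scale K) => //.
  apply/measurable_EFinP/measurable_funTS/measurableT_comp => //.
  by apply: measurableT_comp => //; apply: measurable_funM.
move=> t /=; rewrite in_itv/= andbT lee_fin ger0_norm ?expR_ge0// => t0.
exact: le_trans (h t t0) (ler_norm _).
Qed.

Lemma bigcup_itvcc_exhaust (R : realType) (f : R -> R) :
    {in Num.nneg &, {homo f : x y / x <= y}} ->
    (forall t, 0 < t -> exists2 s, 0 < s & f s = t) ->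
    (forall s, 0 < s -> 0 < f s) ->
  \bigcup_n `[f n.+1%:R^-1, f n.+1%:R]%classic = `]0, +oo[%classic.
Proof.
move=> fnd fsurj f0; apply/seteqP; split => [t [n _] /=|t /=].
  rewrite !in_itv/= andbT => /andP[+ _]; apply: lt_le_trans.
  by apply: f0; rewrite invr_gt0.
rewrite in_itv/= andbT => /fsurj[s s0 <-].
pose m := Num.Def.trunc s; pose k := Num.Def.trunc s^-1.
have ms : s <= (maxn m k).+1%:R.
  by rewrite (le_trans (ltW (truncnS_gt s)))// ler_nat ltnS leq_maxl.
have ks : (maxn m k).+1%:R^-1 <= s.
  rewrite invf_ple ?posrE//.
  by rewrite (le_trans (ltW (truncnS_gt _)))// ler_nat ltnS leq_maxr.
by exists (maxn m k) => //=; rewrite in_itv/= !fnd// ?nnegrE ?invr_ge0// ltW.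
Qed.

Lemma continuous_powRl (R : realType) (p x : R) :
  0 < x -> {for x, continuous (fun s : R => s `^ p)}.
Proof.
move=> x0; apply/differentiable_continuous/derivable1_diffP.
by apply: derivable_powR; rewrite in_itv/= andbT.
Qed.

Lemma integration_by_substitution_powR (R : realType) (k b u v : R)
    (G : R -> R) : 0 < k -> 0 < b -> 0 < u -> u <= v ->
  (forall t, 0 < t -> {for t, continuous G}) ->
  (\int[lebesgue_measure]_(t in `[(k * u `^ b)%R, (k * v `^ b)%R]) (G t)%:E =
   \int[lebesgue_measure]_(s in `[u, v])
     (G (k * s `^ b) * (k * (b * s `^ (b - 1))))%:E)%E.
Proof.
move=> k0 b0 u0 uv cG; pose F (s : R) := k * s `^ b.
pose F' (s : R) := k * (b * s `^ (b - 1)).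
have dF s : 0 < s -> derivable F s 1.
  move=> s0; apply: derivableM => //.
  by apply: derivable_powR; rewrite in_itv/= andbT.
have F'E s : 0 < s -> F^`()%classic s = F' s.
  move=> s0; rewrite derive1Ml.
    by rewrite powR_derive1 ?in_itv/= ?andbT.
  by apply: derivable_powR; rewrite in_itv/= andbT.
have cF' s : 0 < s -> {for s, continuous F'}.
  move=> s0; apply: cvgM; first exact: cvg_cst.
  by apply: cvgM; [exact: cvg_cst|exact: continuous_powRl].
have cF1 s : 0 < s -> {for s, continuous F^`()%classic}.
  move=> s0; rewrite /prop_for /continuous_at F'E//.
  apply: cvg_trans (cF' s s0); apply: near_eq_cvg.
  near=> z; rewrite F'E//; near: z; exact: lt_nbhsr.
have cF s : 0 < s -> {for s, continuous F}.
  by move=> s0; apply: cvgM; [exact: cvg_cst|exact: continuous_powRl].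
have v0 := lt_le_trans u0 uv.
rewrite (@integration_by_substitution_increasing _ F G u v)//.
- apply: eq_integral => s; rewrite inE/= in_itv/= => /andP[us _].
  by rewrite fctE/= F'E// (lt_le_trans u0).
- move=> s t; rewrite !in_itv/= => /andP[us _] /andP[ut _] st.
  rewrite ltr_pM2l// gt0_ltr_powR ?nnegrE//.
    by rewrite (le_trans (ltW u0)).
  by rewrite (le_trans (ltW u0)).
- move=> s; rewrite in_itv/= => /andP[us _].
  by apply: cF1; rewrite (lt_trans u0).
- apply/cvg_ex; exists (F^`()%classic u).
  by apply: cvg_at_right_filter; exact: cF1.
- apply/cvg_ex; exists (F^`()%classic v).
  by apply: cvg_at_left_filter; exact: cF1.
- split.
  + move=> s; rewrite in_itv/= => /andP[us _].
    by apply: dF; rewrite (lt_trans u0).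
  + by apply: cvg_at_right_filter; exact: cF.
  + by apply: cvg_at_left_filter; exact: cF.
- apply: continuous_in_subspaceT => t; rewrite inE/= in_itv/= => /andP[ut _].
  by apply: cG; rewrite (lt_le_trans _ ut)// mulr_gt0 ?powR_gt0.
Unshelve. all: by end_near. Qed.

Lemma integral_itv_exhaust (R : realType) (f : R -> R) (g : R -> \bar R) :
    {in Num.nneg &, {homo f : x y / x <= y}} ->
    (forall t, 0 < t -> exists2 s, 0 < s & f s = t) ->
    (forall s, 0 < s -> 0 < f s) ->
    measurable_fun setT g -> (forall x, 0 <= g x)%E ->
  (\int[lebesgue_measure]_(x in `[(f n.+1%:R^-1)%R, (f n.+1%:R)%R]) g x)%E
    @[n --> \oo] --> (\int[lebesgue_measure]_(x in `]0%R, +oo[) g x)%E.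
Proof.
move=> fnd fsurj f0 mg g0; rewrite -(bigcup_itvcc_exhaust fnd fsurj f0).
apply: ge0_nondecreasing_set_cvg_integral => //.
- move=> m n mn; apply/subsetPset => x /=; rewrite !in_itv/= => /andP[mx xm].
  apply/andP; split.
    apply: le_trans mx; apply: fnd; rewrite ?nnegrE ?invr_ge0//.
    by rewrite lef_pV2 ?posrE// ler_nat.
  by apply: le_trans xm _; apply: fnd; rewrite ?nnegrE// ler_nat.
- by move=> n; apply: measurable_funTS.
Qed.

(* The substitution t = (s / c)^(1/a) is made on the compact intervals
   [1/(n+1), n+1], since its derivative is unbounded at 0 or at infinity. *)
Lemma integral_expRN_powR (R : realType) (c a : R) : 0 < c -> 0 < a ->
  (\int[lebesgue_measure]_(t in `[0%R, +oo[) (expR (- (c * t `^ a)))%:E =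
   (Gamma a^-1 * a^-1 * (c `^ a^-1)^-1)%:E)%E.
Proof.
move=> c0 a0; set b := a^-1; pose k := (c `^ b)^-1.
have b0 : 0 < b by rewrite invr_gt0.
have k0 : 0 < k by rewrite invr_gt0 powR_gt0.
pose G (t : R) := expR (- (c * t `^ a)).
pose g (s : R) := s `^ (b - 1) * expR (- s).
have mG : measurable_fun setT (EFin \o G).
  apply/measurable_EFinP; apply: measurableT_comp => //.
  by apply: measurableT_comp => //; apply: measurable_funM.
have mg : measurable_fun setT (EFin \o g).
  apply/measurable_EFinP; apply: measurable_funM => //.
  by apply: measurableT_comp => //; exact: measurableT_comp.
have g0 x : (0 <= (EFin \o g) x)%E.
  by rewrite lee_fin mulr_ge0 ?powR_ge0 ?expR_ge0.
have IG : (\int[lebesgue_measure]_(t in `[0%R, +oo[) (G t)%:E =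
    (k * b)%:E * \int[lebesgue_measure]_(s in `]0%R, +oo[) (g s)%:E)%E.
  rewrite -integral_itv_obnd_cbnd; last exact: measurable_funTS.
  rewrite -ge0_integralZl//; last 3 first.
  - exact: measurable_funTS.
  - by move=> x _; exact: g0.
  - by rewrite lee_fin mulr_ge0// ltW.
  have lhs : (\int[lebesgue_measure]_(t in
      `[(k * n.+1%:R^-1 `^ b)%R, (k * n.+1%:R `^ b)%R]) (G t)%:E)%E @[n --> \oo]
      --> (\int[lebesgue_measure]_(t in `]0%R, +oo[) (G t)%:E)%E.
    apply: (@integral_itv_exhaust R (fun s => k * s `^ b)) => //.
    - move=> x y x0 y0 xy; rewrite ler_pM2l//.
      by rewrite ge0_ler_powR// ltW.
    - move=> t t0; exists (c * t `^ a); first by rewrite mulr_gt0 ?powR_gt0.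
      rewrite powRM ?powR_ge0 ?(ltW c0)// mulKf ?gt_eqF ?powR_gt0//.
      by rewrite -powRrM mulfV ?gt_eqF// powRr1// ltW.
    - by move=> s s0; rewrite mulr_gt0 ?powR_gt0.
    - by move=> x; rewrite lee_fin expR_ge0.
  have rhs : (\int[lebesgue_measure]_(s in
      `[(n.+1%:R^-1)%R, (n.+1%:R)%R]) ((k * b)%:E * (g s)%:E))%E @[n --> \oo]
      --> (\int[lebesgue_measure]_(s in `]0%R, +oo[) ((k * b)%:E * (g s)%:E))%E.
    apply: (@integral_itv_exhaust R id) => //.
    - by move=> t t0; exists t.
    - exact: measurable_funeM.
    - by move=> x; apply: mule_ge0; [rewrite lee_fin ltW ?mulr_gt0|exact: g0].
  apply: cvg_unique lhs _ => //; apply: cvg_trans rhs; apply: near_eq_cvg.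
  near=> n; rewrite integration_by_substitution_powR//.
  - apply: eq_integral => s; rewrite inE/= in_itv/= => /andP[ns _].
    have s0 : 0 < s by apply: lt_le_trans ns; rewrite invr_gt0.
    rewrite -EFinM /G /g; congr EFin.
    rewrite powRM ?powR_ge0 ?(ltW k0)// -powRrM mulVf ?gt_eqF//.
    rewrite powRr1 ?(ltW s0)//.
    rewrite /k -powRN -powRrM mulNr mulVf ?gt_eqF// powR_inv1 ?(ltW c0)//.
    by rewrite mulVKf ?gt_eqF// [RHS]mulrC !mulrA.
  - by rewrite invf_ple ?posrE// (@le_trans _ _ 1)// ?invf_le1// ler1n.
  - move=> t t0; apply: continuous_comp; last exact: continuous_expR.
    by apply: cvgN; apply: cvgM; [exact: cvg_cst|exact: continuous_powRl].
have kb0 : 0 < k * b by rewrite mulr_gt0.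
have fin : (\int[lebesgue_measure]_(s in `]0%R, +oo[) (g s)%:E)%E \is a fin_num.
  rewrite ge0_fin_numE; last by apply: integral_ge0 => x _; exact: g0.
  have := integral_expRN_powR_lty c0 a0; rewrite IG.
  by rewrite -lte_pdivlMl// => /lt_le_trans; apply; exact: leey.
by rewrite IG -(fineK fin) -EFinM mulrC mulrA mulrAC.
Unshelve. all: by end_near. Qed.

(** * The law of the sample minimum and its limit *)

Lemma sample_min_preimage (d : measure_display) (T : measurableType d)
    (R : realType) (G : nat -> {mfun T >-> R}) (A : set R) (n : nat) :
  (forall x y, x <= y -> A x -> A y) ->
  sample_min G n.+1 @^-1` A =
  \bigcap_(i in [set` iota 0 n.+1]) (G i @^-1` A).
Proof.
move=> Aup; apply/seteqP; split => w.
  move=> Aw i; rewrite /mkset mem_iota /= => i_n; apply: Aup Aw.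
  by rewrite /sample_min; exact: (@bigmin_le _ _ _ _ (Ordinal i_n)).
move=> Aw; rewrite /sample_min.
apply: big_ind => [|x y Ax Ay|i _].
- by apply: (Aw 0%N); rewrite /mkset mem_iota.
- by rewrite /Order.min; case: ifP.
- by apply: (Aw i); rewrite /mkset mem_iota ltn_ord.
Qed.

Lemma iid_sample_min (d : measure_display) (T : measurableType d)
    (R : realType) (P : probability T R) (G : nat -> {RV P >-> R})
    (A : set R) (n : nat) :
  iid G -> measurable A -> (forall x y, x <= y -> A x -> A y) ->
  P (sample_min G n.+1 @^-1` A) = (P (G 0%N @^-1` A) ^+ n.+1)%E.
Proof.
move=> [Gind Gid] mA Aup; rewrite sample_min_preimage//.
rewrite (Gind _ (fun=> A)) ?iota_uniq//.
rewrite (eq_bigr (fun=> P (G 0%N @^-1` A))) => [|i _]; last exact: (Gid i 0%N).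
rewrite big_const_seq count_predT size_iota.
by elim: n.+1 => // m IHm; rewrite expeS -IHm.
Qed.

Lemma sample_min_le0 (d : measure_display) (T : measurableType d)
    (R : realType) (G : nat -> {mfun T >-> R}) (n : nat) (w : T) :
  sample_min G n w <= G 0%N w.
Proof. exact: bigmin_le_id. Qed.

Lemma sample_min_ge0 (d : measure_display) (T : measurableType d)
    (R : realType) (G : nat -> {mfun T >-> R}) (n : nat) (w : T) :
  (forall k, 0 <= G k w) -> 0 <= sample_min G n w.
Proof. by move=> G0; apply: le_bigmin. Qed.

Lemma ccdf_sample_min (d : measure_display) (T : measurableType d)
    (R : realType) (P : probability T R) (G : nat -> {RV P >-> R}) :
  iid G -> forall n t,
  ccdf (sample_min G n.+1 : {RV P >-> R}) t = (ccdf (G 0%N) t ^+ n.+1)%E.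
Proof.
move=> Giid n t.
apply: (@iid_sample_min _ _ _ _ _ `]t, +oo[%classic) => // x y xy /=.
by rewrite !in_itv/= !andbT => /lt_le_trans; apply.
Qed.

Lemma lt_powRV (R : realType) (a x y : R) : 0 < a -> 0 <= x -> 0 <= y ->
  (x < y `^ a^-1) = (x `^ a < y).
Proof.
move=> a0 x0 y0; have a'0 : 0 < a^-1 by rewrite invr_gt0.
have powK (b z : R) : b != 0 -> 0 <= z -> z `^ b^-1 `^ b = z.
  by move=> b0 z0; rewrite -powRrM mulVf// powRr1.
apply/idP/idP => [xy|xy].
  rewrite -[ltRHS](powK a) ?gt_eqF//.
  by apply: gt0_ltr_powR => //; rewrite nnegrE ?powR_ge0.
rewrite -[ltLHS](powK a^-1) ?gt_eqF// invrK.
by apply: gt0_ltr_powR => //; rewrite nnegrE ?powR_ge0.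
Qed.

(* The clipping at 0 matters only for u > 1; for u <= 0, [ln u] is the junk
   value 0. *)
Definition limit_min (R : realType) (c a : R) : measurableTypeR R -> R :=
  fun u => (Order.max 0 (- ln u) / c) `^ a^-1.

Lemma measurable_limit_min (R : realType) (c a : R) :
  measurable_fun setT (limit_min c a).
Proof.
apply: (measurableT_comp (measurable_powR _)).
apply: measurable_funM => //; apply: measurable_maxr => //.
by apply: measurableT_comp => //; exact: measurable_ln.
Qed.

HB.instance Definition _ (R : realType) (c a : R) :=
  isMeasurableFun.Build _ _ _ _ (limit_min c a) (measurable_limit_min c a).

Lemma limit_min_gt (R : realType) (c a t u : R) : 0 < c -> 0 < a -> 0 <= t ->
  (t < limit_min c a u) = (0 < u < expR (- (c * t `^ a))).
Proof.
move=> c0 a0 t0.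
have s0 : 0 <= c * t `^ a by rewrite mulr_ge0 ?powR_ge0// ltW.
rewrite /limit_min lt_powRV//; last first.
  by rewrite divr_ge0 ?le_max ?lexx// ltW.
rewrite ltr_pdivlMr// mulrC lt_max ltNge s0 /= ltrNr.
have [u0|u0] := leP u 0; first by rewrite ln0// oppr_gt0 ltNge s0.
by rewrite -[in RHS](lnK u0) ltr_expR.
Qed.

Lemma uniform_prob_limit_min_gt (R : realType) (c a t : R) :
    0 < c -> 0 < a -> 0 <= t ->
  uniform_prob (@ltr01 R) [set u | t < limit_min c a u] =
    (expR (- (c * t `^ a)))%:E.
Proof.
move=> c0 a0 t0; have s0 : 0 <= c * t `^ a by rewrite mulr_ge0 ?powR_ge0// ltW.
rewrite (_ : [set u | _] = `]0, expR (- (c * t `^ a))[%classic); last first.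
  by apply/seteqP; split => u /=; rewrite limit_min_gt// in_itv.
rewrite /uniform_prob (eq_integral (cst 1%:E)) => [|u]; last first.
  rewrite inE/= in_itv/= /uniform_pdf => /andP[u0 u1].
  rewrite (ltW u0) (le_trans (ltW u1)) ?subr0 ?invr1//.
  by rewrite -[leRHS]expR0 ler_expR oppr_le0.
rewrite integral_cst//= mul1e lebesgue_measure_itv/= lte_fin expR_gt0.
by rewrite sube0.
Qed.

Lemma limit_min_ge0 (R : realType) (c a u : R) : 0 <= limit_min c a u.
Proof. exact: powR_ge0. Qed.

Definition limit_rv (R : realType) (c a : R) :
  {RV (uniform_prob (@ltr01 R)) >-> R} := limit_min c a.

Lemma ccdf_limit_min (R : realType) (c a t : R) : 0 < c -> 0 < a -> 0 <= t ->
  ccdf (limit_rv c a) t = (expR (- (c * t `^ a)))%:E.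
Proof.
move=> c0 a0 t0; rewrite -(uniform_prob_limit_min_gt c0 a0 t0).
rewrite /ccdf /distribution /pushforward; congr (uniform_prob _ _).
by apply/seteqP; split => u /=; rewrite in_itv/= andbT.
Qed.

Lemma cdf_lt0 (d : measure_display) (T : measurableType d) (R : realType)
    (P : probability T R) (X : {RV P >-> R}) (t : R) :
  (forall w, 0 <= X w) -> t < 0 -> cdf X t = 0%E.
Proof.
move=> X0 t0; rewrite /cdf /distribution /pushforward.
rewrite (_ : _ @^-1` _ = set0) ?measure0//; apply/seteqP; split => // w /=.
by rewrite in_itv/= => /(le_trans (X0 w)); rewrite leNgt t0.
Qed.

Lemma cdf_limit_min (R : realType) (c a t : R) : 0 < c -> 0 < a ->
  cdf (limit_rv c a) t = (limit_cdf c a t)%:E.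
Proof.
move=> c0 a0; rewrite /limit_cdf; case: ifPn => [t0|].
  by rewrite cdf_1_ccdf ccdf_limit_min.
by rewrite -ltNge => /cdf_lt0; apply=> u; exact: limit_min_ge0.
Qed.

Lemma expectation_limit_min (R : realType) (c a : R) : 0 < c -> 0 < a ->
  ('E_(uniform_prob (@ltr01 R))[limit_rv c a] =
  \int[lebesgue_measure]_(t in `[0%R, +oo[) (expR (- (c * t `^ a)))%:E)%E.
Proof.
move=> c0 a0.
rewrite (@ge0_expectation_ccdf _ _ _ _ (limit_rv c a)); last first.
  exact: limit_min_ge0.
apply: eq_integral => t; rewrite inE/= in_itv/= andbT => t0.
exact: ccdf_limit_min.
Qed.

Lemma cvg_exprBn (R : realType) (a : R) (x : nat -> R) :
  n%:R * x n @[n --> \oo] --> a -> (1 - x n) ^+ n @[n --> \oo] --> expR (- a).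
Proof.
move=> nxa.
have x0 : x n @[n --> \oo] --> (0 : R).
  rewrite -cvg_shiftS.
  have nxa' : n.+1%:R * x n.+1 @[n --> \oo] --> a.
    by rewrite (cvg_shiftS (fun n => n%:R * x n)).
  have := cvgM (@cvg_harmonic R) nxa'; rewrite mul0r.
  rewrite (_ : _ \* _ = fun n => x n.+1).
    exact.
  by apply/funext => n; rewrite /= mulKf.
have lb : expR (- (n%:R * x n / (1 - x n))) @[n --> \oo] --> expR (- a).
  apply: continuous_cvg; first exact: continuous_expR.
  apply: cvgN; have := cvgM nxa (cvgV _ (cvgB (cvg_cst (1 : R)) x0)).
  by rewrite subr0 invr1 mulr1; apply; exact: oner_neq0.
have ub : expR (- (n%:R * x n)) @[n --> \oo] --> expR (- a).
  by apply: continuous_cvg; [exact: continuous_expR|exact: cvgN].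
apply: (squeeze_cvgr _ lb ub); near=> n.
have xn1 : x n < 1 by near: n; exact: (cvgr_lt 0).
have xn1' : 0 < 1 - x n by rewrite subr_gt0.
rewrite -mulrA -!mulrN !expRM_natl !mulrN; apply/andP; split.
  apply: lerXn2r; rewrite ?nnegrE ?expR_ge0// ?(ltW xn1')//.
  rewrite expRN invf_ple ?posrE ?expR_gt0//.
  apply: le_trans (expR_ge1Dx _).
  suff -> : 1 + x n / (1 - x n) = (1 - x n)^-1 by [].
  by field; rewrite gt_eqF.
apply: lerXn2r; rewrite ?nnegrE ?expR_ge0// ?(ltW xn1')//.
exact: expR_ge1Dx.
Unshelve. all: by end_near. Qed.

Lemma cvg_to_at_right (T : Type) (R : realType) (F : set_system T)
    {FF : Filter F} (y : T -> R) (l : R) :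
  (\forall x \near F, l < y x) -> y x @[x --> F] --> l ->
  y x @[x --> F] --> l^'+.
Proof.
move=> ly yl A /= Al; have := yl _ Al; rewrite /= => h.
by near=> x; apply: (near h x) => //; near: x.
Unshelve. all: by end_near. Qed.

Lemma cvg_powR_natV0 (R : realType) (b t : R) : 0 < b -> 0 < t ->
  t / n%:R `^ b @[n --> \oo] --> 0^'+.
Proof.
move=> b0 t0; apply: cvg_to_at_right.
  by near=> n; rewrite divr_gt0 ?powR_gt0// ltr0n; near: n; exists 1%N.
rewrite -cvg_shiftS.
have h0 : @harmonic R n @[n --> \oo] --> 0^'+.
  apply: cvg_to_at_right; last exact: cvg_harmonic.
  by near=> n; rewrite /= invr_gt0.
have := cvgM (cvg_cst t) (cvg_comp _ _ h0 (powR_cvg0 b0)); rewrite mulr0.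
move=> /(_ _ _); apply: cvg_trans; apply: near_eq_cvg; near=> n => /=.
by rewrite -powRN -powR_inv1// -powRrM mulN1r.
Unshelve. all: by end_near. Qed.

Lemma cvg_scaled_tail (R : realType) (F : R -> R) (c a t : R) :
    0 < c -> 0 < a -> 0 < t ->
    asymp_equiv 0^'+ F (fun x => c * x `^ a) ->
  (1 - F (t / n%:R `^ a^-1)) ^+ n @[n --> \oo] --> expR (- (c * t `^ a)).
Proof.
move=> c0 a0 t0 Fequiv; apply: cvg_exprBn.
have a'0 : 0 < a^-1 by rewrite invr_gt0.
have := cvgM (cvg_comp _ _ (cvg_powR_natV0 a'0 t0) Fequiv)
  (cvg_cst (c * t `^ a)); rewrite mul1r.
move=> /(_ _ _); apply: cvg_trans; apply: near_eq_cvg; near=> n => /=.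
have n0 : 0 < n%:R :> R by rewrite ltr0n; near: n; exists 1%N.
rewrite powRM ?invr_ge0 ?powR_ge0 ?(ltW t0)//.
rewrite -powRN -powRrM mulNr mulVf ?gt_eqF// powR_inv1 ?(ltW n0)//.
by field; rewrite !gt_eqF ?powR_gt0.
Unshelve. all: by end_near. Qed.

Lemma asymp_equiv_powR_le0 (R : realType) (F : R -> R) (c a : R) :
    0 < a -> {homo F : x y / x <= y} ->
    asymp_equiv 0^'+ F (fun x => c * x `^ a) -> c != 0 -> F 0 <= 0.
Proof.
move=> a0 Fnd Fequiv c0.
have h := cvgM Fequiv (cvgM (cvg_cst c) (powR_cvg0 a0)).
have {h} h : F x @[x --> 0^'+] --> (0 : R).
  rewrite mulr0 mulr0 in h; move: h => /(_ _ _ _).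
  apply: cvg_trans; apply: near_eq_cvg.
  near=> x; have x0 : 0 < x by near: x; exact: nbhs_right_gt.
  by rewrite /= divfK// mulf_neq0// gt_eqF// powR_gt0.
apply: (cvgr_to_ge h); near=> x; apply: Fnd; apply: ltW.
by near: x; exact: nbhs_right_gt.
Unshelve. all: by end_near. Qed.

Lemma ccdf_scaled_min (d : measure_display) (T : measurableType d)
    (R : realType) (P : probability T R) (G : nat -> {RV P >-> R}) (a t : R)
    (n : nat) :
  ccdf (scaled_min a G n.+1 : {RV P >-> R}) t =
  ccdf (sample_min G n.+1 : {RV P >-> R}) (t / n.+1%:R `^ a^-1).
Proof.
rewrite /ccdf /distribution /pushforward; congr (P _).
apply/seteqP; split => w /=; rewrite !in_itv/= !andbT ltr_pdivrMr ?powR_gt0//;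
  by rewrite mulrC.
Qed.

Lemma cvg_ccdf_scaled_min (d : measure_display) (T : measurableType d)
    (R : realType) (P : probability T R) (G : nat -> {RV P >-> R}) (F : R -> R)
    (c a t : R) :
    iid G -> (forall x, cdf (G 0%N) x = (F x)%:E) -> 0 < c -> 0 < a ->
    asymp_equiv 0^'+ F (fun x => c * x `^ a) -> 0 < t ->
  ccdf (scaled_min a G n : {RV P >-> R}) t @[n --> \oo] -->
    (expR (- (c * t `^ a)))%:E.
Proof.
move=> Giid GF c0 a0 Fequiv t0; rewrite -cvg_shiftS.
rewrite (_ : (fun n => _) =
    fun n => ((1 - F (t / n.+1%:R `^ a^-1)) ^+ n.+1)%:E); last first.
  apply/funext => n.
  by rewrite ccdf_scaled_min ccdf_sample_min// ccdf_1_cdf GF EFin_expe.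
apply/cvg_EFin; first exact: nearW.
by have := @cvg_scaled_tail R F c a t c0 a0 t0 Fequiv; rewrite -cvg_shiftS.
Qed.

Lemma cvg_in_distribution_scaled_min (d : measure_display)
    (T : measurableType d) (R : realType) (P : probability T R)
    (G : nat -> {RV P >-> R}) (F : R -> R) (c a : R) :
    iid G -> (forall k w, 0 <= G k w) -> (forall x, cdf (G 0%N) x = (F x)%:E) ->
    0 < c -> 0 < a -> asymp_equiv 0^'+ F (fun x => c * x `^ a) ->
  cvg_in_distribution (fun n => scaled_min a G n : {RV P >-> R}) (limit_rv c a).
Proof.
move=> Giid G0 GF c0 a0 Fequiv t _; rewrite cdf_limit_min// /limit_cdf.
have Y0 n w : 0 <= scaled_min a G n w.
  by rewrite mulr_ge0 ?powR_ge0// sample_min_ge0.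
have [t0|t0|->] := ltgtP t 0.
- rewrite (_ : (fun n => _) = cst 0%E); first exact: cvg_cst.
  by apply/funext => n; apply: cdf_lt0 => // w; exact: Y0.
- rewrite (_ : (fun n => _) =
      fun n => (1 - ccdf (scaled_min a G n : {RV P >-> R}) t)%E); last first.
    by apply/funext => n; rewrite cdf_1_ccdf.
  rewrite EFinB; apply: cvgeB => //; first exact: cvg_cst.
  exact: cvg_ccdf_scaled_min GF c0 a0 Fequiv t0.
have F0 : F 0 = 0.
  apply/le_anti/andP; split.
    apply: asymp_equiv_powR_le0 Fequiv _; rewrite ?gt_eqF//.
    by move=> x y xy; rewrite -lee_fin -!GF cdf_nondecreasing.
  by rewrite -lee_fin -GF cdf_ge0.
rewrite powR0 ?gt_eqF// mulr0 oppr0 expR0 subrr -cvg_shiftS.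
rewrite (_ : (fun n => _) = cst 0%:E); first exact: cvg_cst.
apply/funext => n.
rewrite cdf_1_ccdf ccdf_scaled_min mul0r ccdf_sample_min// ccdf_1_cdf GF F0.
by rewrite sube0 -EFin_expe expr1n subee.
Qed.

Lemma scaled_tail_bound (R : realType) (F : R -> R) (c a m : R) :
    0 < c -> 0 < a -> {homo F : x y / x <= y} -> (forall x, F x <= 1) ->
    (forall x, 0 < x -> 1 - F x <= m / x) ->
    asymp_equiv 0^'+ F (fun x => c * x `^ a) ->
  exists2 K : R, 0 < K & forall n t, 0 < t ->
    (1 - F (t / n.+2%:R `^ a^-1)) ^+ n.+2 <= K * (oneDsqr t)^-1.
Proof.
move=> c0 a0 Fnd F1 Fm Fequiv.
have [d d0 Fd] : exists2 d, 0 < d &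
    forall x, 0 < x -> x <= d -> c / 2%:R * x `^ a <= F x.
  have : \forall x \near (0 : R)^'+, 1 / 2%:R < F x / (c * x `^ a).
    by apply: (cvgr_gt _ Fequiv); lra.
  move=> [e /= e0 he].
  exists (e / 2%:R) => [|x x0 xe]; first by rewrite divr_gt0.
  have xce : x < e by lra.
  have := he x; rewrite /= sub0r normrN gtr0_norm// => /(_ xce x0).
  have cx0 : 0 < c * x `^ a by rewrite mulr_gt0 ?powR_gt0.
  by rewrite ltr_pdivlMr// => /ltW; rewrite div1r mulrA (mulrC _^-1).
have r0 : 0 < F d.
  by apply: lt_le_trans (Fd _ d0 _); rewrite // mulr_gt0 ?powR_gt0 ?divr_gt0.
have c20 : 0 < c / 2%:R by rewrite divr_gt0.
have [K1 K10 h1] := expRN_powR_le c20 a0.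
have a'0 : 0 < a^-1 by rewrite invr_gt0.
have p0 : 0 < a^-1 * 2%:R by rewrite mulr_gt0.
have [K2 K20 h2] := powR_le_expR p0 r0 ltr01.
have S0 x : 0 <= 1 - F x by rewrite subr_ge0.
have Sexp x y : y <= F x -> 1 - F x <= expR (- y).
  move=> yF; apply: le_trans (expR_ge1Dx _); lra.
exists (K1 + (m ^+ 2 / d ^+ 2 + m ^+ 2 * (K2 * expR (F d *+ 2)))) => [|n t t0].
  apply: (lt_le_trans K10); rewrite lerDl addr_ge0// mulr_ge0 ?sqr_ge0//.
    by rewrite invr_ge0 sqr_ge0.
  by rewrite mulr_ge0 ?expR_ge0// ltW.
have n0 : 0 < n.+2%:R :> R by rewrite ltr0n.
set k := n.+2%:R `^ a^-1.
have k0 : 0 < k by rewrite powR_gt0.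
have x0 : 0 < t / k by rewrite divr_gt0.
have q0 : 0 < oneDsqr t by rewrite (lt_le_trans ltr01)// oneDsqr_ge1.
(* Below d all factors are controlled by the power law of F at 0; above d
   the first n factors are at most exp(- F d), which absorbs the growth of k
   in the bound m / (t / k) of the last two. *)
rewrite mulrDl; have [xd|dx] := leP (t / k) d.
  rewrite -[leLHS]addr0; apply: lerD; last first.
    rewrite mulr_ge0 ?invr_ge0 ?(ltW q0)// addr_ge0//.
      by rewrite mulr_ge0 ?invr_ge0 ?sqr_ge0.
    by rewrite mulr_ge0 ?sqr_ge0// mulr_ge0 ?expR_ge0// ltW.
  apply: le_trans (h1 t (ltW t0)).
  have -> : - (c / 2%:R * t `^ a) = n.+2%:R * - (c / 2%:R * (t / k) `^ a).
    rewrite powRM ?invr_ge0 ?(ltW k0) ?(ltW t0)//.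
    rewrite /k -powRN -powRrM mulNr mulVf ?gt_eqF// powR_inv1 ?(ltW n0)//.
    by field; rewrite gt_eqF.
  rewrite expRM_natl; apply: lerXn2r; rewrite ?nnegrE ?expR_ge0//.
  exact/Sexp/Fd.
rewrite -[leLHS]add0r; apply: lerD.
  by rewrite mulr_ge0 ?invr_ge0 ?(ltW K10) ?(ltW q0).
rewrite ler_pdivlMr// -addn2 exprD.
have e1 : (1 - F (t / k)) ^+ n <= expR (- (n%:R * F d)).
  rewrite -mulrN expRM_natl; apply: lerXn2r; rewrite ?nnegrE ?expR_ge0//.
  by apply: Sexp; apply: Fnd; exact: ltW.
have e2 : (1 - F (t / k)) ^+ 2 <= (m / (t / k)) ^+ 2.
  apply: lerXn2r; rewrite ?nnegrE//; last exact: Fm.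
  exact: le_trans (Fm _ x0).
apply: (@le_trans _ _ (expR (- (n%:R * F d)) * (m / (t / k)) ^+ 2 * oneDsqr t)).
  by rewrite ler_wpM2r ?(ltW q0)// ler_pM// ?exprn_ge0.
have -> : expR (- (n%:R * F d)) * (m / (t / k)) ^+ 2 * oneDsqr t =
    expR (- (n%:R * F d)) * (m ^+ 2 / (t / k) ^+ 2) +
    m ^+ 2 * (k ^+ 2 * expR (- (n%:R * F d))).
  by rewrite /oneDsqr; field; rewrite !gt_eqF.
apply: lerD.
  rewrite -[leRHS]mul1r; apply: ler_pM; rewrite ?expR_ge0//.
  - by rewrite mulr_ge0 ?invr_ge0 ?sqr_ge0.
  - by rewrite -[leRHS]expR0 ler_expR oppr_le0 mulr_ge0// ltW.
  - rewrite ler_wpM2l ?sqr_ge0// lef_pV2 ?posrE ?exprn_gt0//.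
    by apply: lerXn2r; rewrite ?nnegrE ltW.
rewrite ler_wpM2l ?sqr_ge0// expRN ler_pdivrMr ?expR_gt0//.
rewrite -mulrA -expRD -powR_mulrn ?(ltW k0)// -powRrM.
have := h2 _ (ltW n0); rewrite powRr1 ?(ltW n0)// => /le_trans; apply.
suff -> : F d * n.+2%:R = F d *+ 2 + n%:R * F d by [].
by rewrite -addn2 natrD; ring.
Qed.

Lemma ccdf_le_expectation (d : measure_display) (T : measurableType d)
    (R : realType) (P : probability T R) (X : {RV P >-> R}) (t : R) :
  (forall w, 0 <= X w) -> 0 < t -> (t%:E * ccdf X t <= 'E_P[X])%E.
Proof.
move=> X0 t0; have := markov X t0 (@measurable_id _ R setT) (fun _ => id).
move=> /(_ (fun _ _ _ _ => id)) => h; apply: le_trans (le_trans h _).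
  apply: lee_wpmul2l; first by rewrite lee_fin ltW.
  have -> : [set w | (t%:E <= `|(X w)%:E|)%E] = X @^-1` `[t, +oo[.
    apply/seteqP; split => w /=;
      by rewrite in_itv/= andbT lee_fin ger0_norm.
  rewrite le_measure ?inE//; [exact: measurable_funPTI..|].
  by move=> w /=; rewrite !in_itv/= !andbT => /ltW.
rewrite le_eqVlt; apply/orP; left; apply/eqP.
by congr expectation; apply/funext => w; rewrite /= ger0_norm.
Qed.

Lemma cvg_scaled_expectation (d : measure_display) (T : measurableType d)
    (R : realType) (P : probability T R) (X : {RV P >-> R})
    (Y : nat -> {RV P >-> R}) (F : R -> R) (c a : R) :
    0 < c -> 0 < a -> (forall w, 0 <= X w) -> (forall n w, 0 <= Y n w) ->
    (forall x, cdf X x = (F x)%:E) ->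
    (forall n t, ccdf (Y n.+1) t = (ccdf X t ^+ n.+1)%E) ->
    asymp_equiv 0^'+ F (fun x => c * x `^ a) -> ('E_P[X] < +oo)%E ->
  ((n%:R `^ a^-1)%:E * 'E_P[Y n])%E @[n --> \oo] -->
    (\int[lebesgue_measure]_(t in `[0%R, +oo[) (expR (- (c * t `^ a)))%:E)%E.
Proof.
move=> c0 a0 X0 Y0 FE Ymin Fequiv EXoo.
have EX : ('E_P[X] = (fine 'E_P[X])%:E)%E.
  by rewrite fineK// ge0_fin_numE// expectation_ge0.
have ccdfX t : ccdf X t = (1 - F t)%:E by rewrite ccdf_1_cdf FE.
have [K K0 hK] : exists2 K : R, 0 < K & forall n t, 0 < t ->
    (1 - F (t / n.+2%:R `^ a^-1)) ^+ n.+2 <= K * (oneDsqr t)^-1.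
  apply: (@scaled_tail_bound _ F c a (fine 'E_P[X])%E) => //.
  - by move=> x y xy; rewrite -lee_fin -!FE; exact: cdf_nondecreasing.
  - by move=> x; rewrite -lee_fin -FE; exact: cdf_le1.
  - move=> x x0; rewrite ler_pdivlMr// mulrC -lee_fin EFinM -ccdfX -EX.
    exact: ccdf_le_expectation.
pose k n : R := n.+2%:R `^ a^-1.
have k0 n : 0 < k n by rewrite powR_gt0.
pose f n (t : R) := ((1 - F (t / k n)) ^+ n.+2)%:E.
have fE n t : ccdf (Y n.+2) (t / k n) = f n t.
  by rewrite Ymin ccdfX /f EFin_expe.
have mf n : measurable_fun setT (f n).
  apply: (eq_measurable_fun (ccdf (Y n.+2) \o (fun t => t / k n))) => //.
  by move=> t _; exact: fE.
  apply: (measurableT_comp (ccdf_measurable (Y n.+2))).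
  exact: measurable_funM.
have me : measurable_fun setT (fun t : R => (expR (- (c * t `^ a)))%:E).
  apply/measurable_EFinP; apply: measurableT_comp => //.
  by apply: measurableT_comp => //; apply: measurable_funM.
have kE n : ((k n)%:E * 'E_P[Y n.+2] =
    \int[lebesgue_measure]_(t in `]0%R, +oo[) f n t)%E.
  pose Z : {RV P >-> R} := [the {mfun T >-> R} of cst (k n) \* Y n.+2].
  transitivity ('E_P[Z])%E.
    rewrite unlock -ge0_integralZl//=.
    - by apply/measurable_EFinP; exact: measurable_funPT.
    - by move=> w _; rewrite lee_fin.
    - by rewrite lee_fin ltW.
  rewrite ge0_expectation_ccdf; last first.
    by move=> w; rewrite /= mulr_ge0 ?(ltW (k0 n)).
  rewrite -integral_itv_obnd_cbnd; last first.
    by apply: measurable_funTS; exact: ccdf_measurable.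
  apply: eq_integral => t _; rewrite -fE /ccdf /distribution /pushforward.
  congr (P _); apply/seteqP; split => w /=;
    by rewrite !in_itv/= !andbT ltr_pdivrMr// mulrC.
rewrite -(cvg_shiftn 2) /=.
rewrite -integral_itv_obnd_cbnd; last exact: measurable_funTS.
apply: (@cvg_trans _
  ((\int[lebesgue_measure]_(t in `]0%R, +oo[) f n t)%E @[n --> \oo])).
  by apply: near_eq_cvg; near=> n; rewrite -kE addn2.
apply: (@dominated_cvg _ _ R lebesgue_measure `]0%R, +oo[%classic _ f
  (fun t => (expR (- (c * t `^ a)))%:E)
  (fun t => (K * (oneDsqr t)^-1)%:E)) => //.
- by move=> n; apply: measurable_funTS; exact: mf.
- move=> t /=; rewrite in_itv/= andbT => t0.
  apply/cvg_EFin; first by near=> n.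
  have := @cvg_scaled_tail R F c a t c0 a0 t0 Fequiv.
  rewrite -(cvg_shiftn 2); apply: cvg_trans; apply: near_eq_cvg.
  by near=> n; rewrite /= addn2.
- apply: integrableS (integrable_oneDsqrV_scale K) => //.
  by apply: subset_itvr; rewrite bnd_simp.
- move=> n t /=; rewrite in_itv/= andbT => t0.
  rewrite ger0_norm; first by rewrite lee_fin; exact: hK.
  by rewrite exprn_ge0// -lee_fin -ccdfX.
Unshelve. all: by end_near. Qed.

(** * Exponential moments *)

Definition expm1 (R : realType) (th x : R) : R := (expR (th * x) - 1) / th.

Lemma measurable_expm1 (R : realType) (th : R) : measurable_fun setT (expm1 th).
Proof.
apply: measurable_funM => //; apply: measurable_funB => //.
by apply: measurableT_comp => //; exact: measurable_funM.
Qed.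

HB.instance Definition _ (R : realType) (th : R) :=
  isMeasurableFun.Build _ _ _ _ (expm1 th) (measurable_expm1 th).

Lemma expm1_mono (R : realType) (th : R) : th != 0 ->
  {mono expm1 th : x y / x <= y}.
Proof.
move=> th0 x y; rewrite /expm1; move: th0; rewrite neq_lt => /orP[th0|th0].
  by rewrite ler_ndivrMr// divfK ?lt_eqF// lerD2r ler_expR ler_nM2l.
by rewrite ler_pM2r ?invr_gt0// lerD2r ler_expR ler_pM2l.
Qed.

Lemma expm1_ge0 (R : realType) (th x : R) : th != 0 -> 0 <= x ->
  0 <= expm1 th x.
Proof.
move=> th0 x0; suff <- : expm1 th 0 = 0 by rewrite expm1_mono.
by rewrite /expm1 mulr0 expR0 subrr mul0r.
Qed.

Lemma expm1_le (R : realType) (th0 th x : R) : 0 < th0 -> th < th0 ->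
  0 <= x -> expm1 th x <= `|th|^-1 * expR (x * th0).
Proof.
move=> th00 th_th0 x0; apply: le_trans (ler_norm _) _.
rewrite normrM normfV mulrC ler_wpM2l ?invr_ge0//.
have e1 : 1 <= expR (x * th0) by rewrite -[leLHS]expR0 ler_expR mulr_ge0// ltW.
have e2 : expR (th * x) <= expR (x * th0).
  by rewrite ler_expR mulrC ler_wpM2l// ltW.
have := expR_ge0 (th * x); rewrite ler_norml => e3; apply/andP; split; lra.
Qed.

Lemma expm1_ln (R : realType) (th t : R) : th != 0 -> 0 < 1 + th * t ->
  expm1 th (ln (1 + th * t) / th) = t.
Proof.
move=> th0 h; rewrite /expm1 mulrC mulrCA mulfV// mulr1 lnK ?posrE//.
by rewrite addrAC subrr add0r mulKf.
Qed.

Lemma cvg_ln1M_div (R : realType) (th : R) : th != 0 ->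
  ln (1 + th * t) / th / t @[t --> 0^'+] --> (1 : R).
Proof.
move=> th0; pose psi (t : R) := ln (1 + th * t) / th.
have dpsi : is_derive (0 : R) 1 psi 1.
  have h1 : is_derive (0 : R) 1 (fun t : R => 1 + th * t) th.
    by apply: is_derive_eq; rewrite add0r mul1r /GRing.scale/= mulr1.
  have h2 : is_derive (1 + th * 0) 1 (@ln R) 1.
    by rewrite mulr0 addr0 -[X in is_derive _ _ _ X]invr1; exact: is_derive1_ln.
  have h3 := @is_derive1_comp R (@ln R) (fun t => 1 + th * t) 0 1 th h2 h1.
  have -> : psi = th^-1 \*: (@ln R \o (fun t : R => 1 + th * t)).
    by apply/funext => t; rewrite /psi mulrC.
  apply: (is_derive_eq (is_deriveZ th^-1 h3)).
  by rewrite /GRing.scale/= mul1r mulVf.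
have cv := @ex_derive _ _ _ _ _ _ _ dpsi.
have dv := @derive_val _ _ _ _ _ _ _ dpsi.
rewrite /derivable /= in cv; rewrite /derive /= in dv; rewrite dv in cv.
apply: cvg_trans (cvg_dnbhs_at_right cv).
apply: near_eq_cvg; near=> t.
rewrite /psi /GRing.scale/= mulr0 !addr0 ln1 mul0r subr0 mulr1.
by rewrite mulrC.
Unshelve. all: by end_near. Qed.

(* [ln (1 + th * t) / th] is the inverse of [expm1 th]. *)
Lemma asymp_equiv_expm1 (R : realType) (F : R -> R) (c a th : R) :
    0 < c -> 0 < a -> th != 0 -> asymp_equiv 0^'+ F (fun x => c * x `^ a) ->
  asymp_equiv 0^'+ (fun t => F (ln (1 + th * t) / th)) (fun x => c * x `^ a).
Proof.
move=> c0 a0 th0 Fequiv; have psiE := cvg_ln1M_div th0.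
pose psi (t : R) := ln (1 + th * t) / th.
have psi_gt0 : \forall t \near (0 : R)^'+, 0 < psi t.
  near=> t; have t0 : 0 < t by near: t; exact: nbhs_right_gt.
  rewrite -[ltRHS](@divfK _ t) ?gt_eqF// mulr_gt0//.
  by near: t; exact: (cvgr_gt _ psiE).
have psi0 : psi t @[t --> 0^'+] --> 0^'+.
  apply: cvg_to_at_right => //.
  have id0 : t @[t --> (0 : R)^'+] --> (0 : R) by exact: cvg_at_right_filter.
  have := cvgM psiE id0; rewrite mulr0 => /(_ _); apply: cvg_trans.
  apply: near_eq_cvg; near=> t => /=.
  by rewrite divfK// gt_eqF//; near: t; exact: nbhs_right_gt.
have pow1 : (psi t / t) `^ a @[t --> 0^'+] --> (1 : R).
  have <- : (1 : R) `^ a = 1 by rewrite powR1.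
  exact: (cvg_comp _ _ psiE (@continuous_powRl R a 1 ltr01)).
have := cvgM (cvg_comp _ _ psi0 Fequiv) pow1; rewrite mulr1 => /(_ _).
apply: cvg_trans; apply: near_eq_cvg; near=> t => /=.
have t0 : 0 < t by near: t; exact: nbhs_right_gt.
have p0 : 0 < psi t by near: t.
rewrite powRM ?invr_ge0 ?(ltW t0) ?(ltW p0)//.
have -> : t^-1 `^ a = (t `^ a)^-1.
  by rewrite -(powR_inv1 (ltW t0)) powRAC powR_inv1 ?powR_ge0.
by field; rewrite !gt_eqF ?powR_gt0.
Unshelve. all: by end_near. Qed.

Lemma ccdf_expm1_sample_min (d : measure_display) (T : measurableType d)
    (R : realType) (P : probability T R) (G : nat -> {RV P >-> R}) (th : R) :
  th != 0 -> iid G -> forall n t,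
  ccdf (expm1 th \o sample_min G n.+1 : {RV P >-> R}) t =
    (ccdf (expm1 th \o G 0%N : {RV P >-> R}) t ^+ n.+1)%E.
Proof.
move=> th0 Giid n t.
apply: (@iid_sample_min _ _ _ _ _ (expm1 th @^-1` `]t, +oo[)) => //.
  exact: measurable_funPTI.
move=> x y xy /=; rewrite !in_itv/= !andbT => /lt_le_trans; apply.
by rewrite expm1_mono.
Qed.

Lemma mmt_gen_fun_expm1 (d : measure_display) (T : measurableType d)
    (R : realType) (P : probability T R) (X : {RV P >-> R}) (th : R) :
  th != 0 -> (forall w, 0 <= X w) -> ('E_P[expm1 th \o X] < +oo)%E ->
  ('M_P X th = 1 + th%:E * 'E_P[expm1 th \o X])%E.
Proof.
move=> th0 X0 Eoo.
have iX : P.-integrable setT (EFin \o (expm1 th \o X)).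
  apply/integrableP; split; first exact/measurable_EFinP/measurable_funPT.
  rewrite (eq_integral (EFin \o (expm1 th \o X))); last first.
    by move=> w _; rewrite /= ger0_norm// expm1_ge0.
  by move: Eoo; rewrite unlock.
rewrite /mmt_gen_fun.
rewrite (_ : expR \o _ = cst 1 \+ (th \o* (expm1 th \o X))); last first.
  apply/funext => w; rewrite /= /expm1 divfK// addrC subrK.
  by rewrite mulrC.
have lX : expm1 th \o X \in Lfun P 1 by exact/Lfun1_integrable.
rewrite expectationD.
- by rewrite expectation_cst expectationZl.
- by rewrite Lfun_cst.
- by rewrite Lfun_scale.
Qed.

Lemma mmt_gen_fun_sample_min_littleo (d : measure_display)
    (T : measurableType d) (R : realType) (P : probability T R)
    (G : nat -> {RV P >-> R}) (F : R -> R) (c a m theta0 theta : R) :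
    iid G -> (forall k w, 0 <= G k w) -> (forall x, cdf (G 0%N) x = (F x)%:E) ->
    0 < c -> 0 < a -> asymp_equiv 0^'+ F (fun x => c * x `^ a) ->
    (\int[lebesgue_measure]_(t in `[0%R, +oo[) (expR (- (c * t `^ a)))%:E =
      m%:E)%E ->
    0 < theta0 -> ('M_P (G 0%N) theta0 < +oo)%E -> theta < theta0 ->
  exists e : nat -> R, e =o_\oo (fun n => n%:R `^ (- a^-1)) /\
    \forall n \near \oo, 'M_P (sample_min G n) theta =
      (1 + theta%:E * m%:E * (n%:R `^ (- a^-1))%:E + (e n)%:E)%E.
Proof.
move=> Giid G0 GF c0 a0 Fequiv mE th00 Moo thth0.
have [->|th0] := eqVneq theta 0.
  exists (fun=> 0); split.
    apply/eqoP => eps eps0; near=> n.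
    by rewrite normr0 mulr_ge0// ltW.
  near=> n; rewrite !mul0e !adde0 /mmt_gen_fun.
  rewrite (_ : expR \o _ = cst 1) ?expectation_cst//.
  by apply/funext => w /=; rewrite mulr0 expR0.
pose X : {RV P >-> R} := expm1 theta \o G 0%N.
pose Y n : {RV P >-> R} := expm1 theta \o sample_min G n.
have M0 n w : 0 <= sample_min G n w by exact: sample_min_ge0.
have X0 w : 0 <= X w by exact: expm1_ge0.
have Y0 n w : 0 <= Y n w by apply: expm1_ge0 => //; exact: M0.
have mexp : measurable_fun setT (fun w => expR (G 0%N w * theta0)).
  by apply: measurableT_comp => //; exact: measurable_funM.
have EXoo : ('E_P[X] < +oo)%E.
  apply: (@le_lt_trans _ _ ((`|theta|^-1)%:E * 'M_P (G 0%N) theta0)%E).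
    rewrite /mmt_gen_fun unlock -ge0_integralZl//=.
    - apply: ge0_le_integral => //=.
      + by move=> w _; rewrite lee_fin; exact: X0.
      + by apply/measurable_EFinP; exact: (measurable_funPT X).
      + exact/measurable_funeM/measurable_EFinP.
      + by move=> w _; rewrite -EFinM lee_fin; exact: expm1_le.
    - exact/measurable_EFinP.
  by rewrite lte_mul_pinfty// lee_fin invr_ge0.
have EYoo n : ('E_P[Y n] < +oo)%E.
  apply: le_lt_trans EXoo; apply: expectation_le => //.
  by apply: aeW => w; rewrite expm1_mono// sample_min_le0.
have EYfin n : ('E_P[Y n])%E \is a fin_num.
  by rewrite ge0_fin_numE ?EYoo//; apply: expectation_ge0 => w; exact: Y0.
have FY : asymp_equiv 0^'+ (fun x => fine (cdf X x)) (fun x => c * x `^ a).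
  apply: cvg_trans (asymp_equiv_expm1 c0 a0 th0 Fequiv).
  apply: near_eq_cvg; near=> t.
  have t0 : 0 < t by near: t; exact: nbhs_right_gt.
  have t1 : 0 < 1 + theta * t.
    have : t < `|theta|^-1.
      by near: t; apply: nbhs_right_lt; rewrite invr_gt0 normr_gt0.
    rewrite -[ltRHS]mul1r ltr_pdivlMr ?normr_gt0// => tth.
    have := ler_norm (- (theta * t)); rewrite normrN normrM (gtr0_norm t0); lra.
  congr (_ / _).
  rewrite (_ : cdf X t = cdf (G 0%N) (ln (1 + theta * t) / theta)).
    by rewrite GF.
  rewrite /cdf /distribution /pushforward; congr (P _).
  have eqt w : (expm1 theta (G 0%N w) <= t) =
      (G 0%N w <= ln (1 + theta * t) / theta).
    by rewrite -{1}(expm1_ln th0 t1) expm1_mono.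
  by apply/seteqP; split => w /=; rewrite !in_itv/= eqt.
have FX x : cdf X x = (fine (cdf X x))%:E by rewrite fineK// fin_num_measure.
have lim := @cvg_scaled_expectation _ _ _ _ X Y _ c a c0 a0 X0 Y0 FX
  (ccdf_expm1_sample_min th0 Giid) FY EXoo.
have {lim} lim : n%:R `^ a^-1 * fine 'E_P[Y n] @[n --> \oo] --> m.
  rewrite mE in lim; have := fine_cvg lim => /(_ _).
  apply: cvg_trans; apply: near_eq_cvg.
  by near=> n; rewrite /= fineM ?EYfin.
exists (fun n => theta * (fine 'E_P[Y n] - m * n%:R `^ (- a^-1))); split.
  apply/eqoP => eps eps0.
  have th0' : 0 < `|theta| by rewrite normr_gt0.
  have eth0 : 0 < eps / `|theta| by rewrite divr_gt0.
  near=> n.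
  have n0 : 0 < n%:R :> R by rewrite ltr0n; near: n; exists 1%N.
  have k0 : 0 < n%:R `^ a^-1 by rewrite powR_gt0.
  have h : `|m - n%:R `^ a^-1 * fine 'E_P[Y n]| <= eps / `|theta|.
    by near: n; move/cvgrPdist_le: lim; apply.
  rewrite powRN (gtr0_norm (_ : 0 < _^-1)) ?invr_gt0// ler_pdivlMr//.
  rewrite -[X in _ * X](gtr0_norm k0) -normrM.
  rewrite ler_pdivlMr// in h; apply: le_trans h.
  rewrite -normrM -normrN le_eqVlt; apply/orP; left; apply/eqP; congr (`|_|).
  by field; rewrite gt_eqF.
near=> n.
rewrite mmt_gen_fun_expm1//; [|exact: M0|exact: EYoo].
rewrite -(fineK (EYfin n)).
rewrite -!EFinM -!EFinD; congr EFin; ring.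
Unshelve. all: by end_near. Qed.

Theorem proposition2p4 (R : realType) (d : measure_display)
  (T : measurableType d) (P : probability T R)
  (G : nat -> {RV P >-> R}) (F : R -> R) (c alpha : R)
  (G_iid : iid G)
  (G_ge0 : forall k w, 0 <= G k w)
  (G_density : forall k, has_density (G k))
  (G_cdf : forall k x, cdf (G k) x = (F x)%:E)
  (F_gt0 : forall x, 0 < x -> 0 < F x)
  (c_gt0 : 0 < c) (alpha_gt0 : 0 < alpha)
  (F_equiv : asymp_equiv (0 : R)^'+ F (fun x => c * x `^ alpha)) :
  exists (d' : measure_display) (T' : measurableType d')
         (P' : probability T' R) (M : {RV P' >-> R}),
  [/\ (forall t : R, cdf M t = (limit_cdf c alpha t)%:E),
      cvg_in_distribution
        (fun n => scaled_min alpha G n : {RV P >-> R}) M /\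
      (forall t : R, 0 < t ->
         (P [set w | t < scaled_min alpha G n w] @[n --> \oo]
            --> P' [set w | t < M w]) /\
         P' [set w | t < M w] = (1 - limit_cdf c alpha t)%:E),
      ((forall k, ('E_P[G k] < +oo)%E) ->
         [/\ ((n%:R `^ alpha^-1)%:E * 'E_P[sample_min G n])%E @[n --> \oo]
               --> ('E_P'[M])%E,
             ('E_P'[M] = \int[lebesgue_measure]_(t in `[0%R, +oo[)
                            (expR (- (c * t `^ alpha)))%:E)%E &
             (\int[lebesgue_measure]_(t in `[0%R, +oo[)
                 (expR (- (c * t `^ alpha)))%:E)%E =
             (Gamma alpha^-1 * alpha^-1 * (c `^ alpha^-1)^-1)%:E]) &
      (forall theta0 : R, 0 < theta0 ->
         (forall k, ('M_P (G k) theta0 < +oo)%E) ->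
         forall theta : R, theta < theta0 ->
         exists e : nat -> R,
           e =o_\oo (fun n => n%:R `^ (- alpha^-1)) /\
           \forall n \near \oo,
             'M_P (sample_min G n) theta =
               (1 + theta%:E * 'E_P'[M] * (n%:R `^ (- alpha^-1))%:E
                  + (e n)%:E)%E)].
Proof.
have GF x : cdf (G 0%N) x = (F x)%:E by exact: G_cdf.
have G0 w : 0 <= G 0%N w by exact: G_ge0.
have EM := expectation_limit_min c_gt0 alpha_gt0.
have IE := integral_expRN_powR c_gt0 alpha_gt0.
exists _, _, (uniform_prob (@ltr01 R)), (limit_rv c alpha); split.
- by move=> t; exact: cdf_limit_min.
- split; first exact: cvg_in_distribution_scaled_min GF _ _ F_equiv.
  move=> t t0; have PM := uniform_prob_limit_min_gt c_gt0 alpha_gt0 (ltW t0).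
  split; last by rewrite /limit_cdf (ltW t0) subKr; exact: PM.
  have := cvg_ccdf_scaled_min G_iid GF c_gt0 alpha_gt0 F_equiv t0; rewrite -PM.
  apply: cvg_trans; apply: near_eq_cvg; near=> n.
  rewrite /ccdf /distribution /pushforward; congr (P _).
  by apply/seteqP; split => w /=; rewrite in_itv/= andbT.
- move=> EG; split => //; rewrite EM.
  apply: (cvg_scaled_expectation c_gt0 alpha_gt0 G0 _ GF _ F_equiv) => //.
  + by move=> n w; exact: sample_min_ge0.
  + exact: ccdf_sample_min.
- move=> theta0 theta0_gt0 MG theta theta_lt; rewrite EM IE.
  exact: (mmt_gen_fun_sample_min_littleo G_iid G_ge0 GF c_gt0 alpha_gt0
    F_equiv IE theta0_gt0 (MG 0%N)).
Unshelve. all: by end_near. Qed.
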